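(* Let $L$ be a pseudocomplemented De Morgan algebra such that $\mathbb{X}(L)$ is $\phi$-connected. If $|Body(L)|<2$, or $Body(L)=\{P,\phi(P)\}$ for some $P$ with $\phi(P)\neq P$, then $L$ is subdirectly irreducible.
   Context: A pseudocomplemented De Morgan algebra ($pm$-algebra) is an algebra $\langle L,\wedge,\vee,{}',{}^*,0,1\rangle$ such that $\langle L,\wedge,\vee,0,1\rangle$ is a bounded distributive lattice, ${}'$ is a De Morgan negation ($x''=x$, $(x\wedge y)'=x'\vee y'$), and ${}^*$ is a pseudocomplement ($a\wedge b=0\Leftrightarrow b\le a^*$). Congruences and subdirect irreducibility are with respect to this full signature. $\mathbb{X}(L)$ denotes the set of prime filters of $L$ ordered by inclusion, and $\phi:\mathbb{X}(L)\to\mathbb{X}(L)$ is the order-reversing involution $\phi(P)=L\setminus\{a':a\in P\}$. $Max$ and $Min$ denote the sets of maximal and minimal elements of $\mathbb{X}(L)$, and $Body(L)=\mathbb{X}(L)\setminus(Max\cup Min)$. A $\phi$-connected component of $\mathbb{X}(L)$ is a non-empty subset that is increasing (an up-set), decreasing (a down-set) and involutive (closed under $\phi$), and is minimal with respect to these properties; $\mathbb{X}(L)$ is $\phi$-connected if it has exactly one $\phi$-connected component. *)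

(* Defs.v *)
From HB Require Import structures.
From mathcomp Require Import all_boot all_order.
From mathcomp Require Import boolp classical_sets functions cardinality.

Set Implicit Arguments.
Unset Strict Implicit.
Unset Printing Implicit Defensive.

Local Open Scope classical_set_scope.

(* Monotonicity of the pseudocomplement, 0' = 1 and (x \/ y)' = x' /\ y' all
   follow from these axioms. *)
HB.mixin Record isPMAlgebra (d : Order.disp_t) L
    of Order.TBDistrLattice d L := {
  dmneg : L -> L;
  pcompl : L -> L;
  dmnegK : involutive dmneg;
  dmnegI : forall x y : L,
    dmneg (Order.meet x y) = Order.join (dmneg x) (dmneg y);
  meet_eq0_pcompl : forall a b : L,
    (Order.meet a b == Order.bottom) = (b <= pcompl a)%O
}.

#[short(type="pmAlgebraType")]
HB.structure Definition PMAlgebra (d : Order.disp_t) :=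
  {L of isPMAlgebra d L & Order.TBDistrLattice d L}.

Section Homomorphisms.
Variables (d d' : Order.disp_t) (L : pmAlgebraType d) (M : pmAlgebraType d').

Record pm_morphism (f : L -> M) : Prop := PMMorphism {
  pm_morphI : Order.meet_morphism f;
  pm_morphU : Order.join_morphism f;
  pm_morph0 : f Order.bottom = Order.bottom;
  pm_morph1 : f Order.top = Order.top;
  pm_morphN : {morph f : x / dmneg x};
  pm_morphC : {morph f : x / pcompl x}
}.

End Homomorphisms.

(* A homomorphism from L into the product of the A i is given by its
   coordinates f i. It is injective when the f i jointly separate points, and
   the image is a subdirect product when every f i is onto. *)
Definition subdirect_embedding d (L : pmAlgebraType d) (I : Type)
    (dA : I -> Order.disp_t) (A : forall i, pmAlgebraType (dA i))
    (f : forall i, L -> A i) : Prop :=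
  [/\ forall i, pm_morphism (f i),
      forall x y : L, (forall i, f i x = f i y) -> x = y
    & forall i (z : A i), exists x : L, f i x = z].

Definition subdirectly_irreducible d (L : pmAlgebraType d) : Prop :=
  forall (I : Type) (dA : I -> Order.disp_t)
    (A : forall i, pmAlgebraType (dA i)) (f : forall i, L -> A i),
  subdirect_embedding f -> exists i, bijective (f i).

Section PrimeFilters.
Variables (d : Order.disp_t) (L : pmAlgebraType d).

Record prime_filter (P : set L) : Prop := PrimeFilter {
  pfilter_nonempty : P !=set0;
  pfilter_proper : P != setT;
  pfilter_up : forall x y : L, (x <= y)%O -> P x -> P y;
  pfilterI : forall x y : L, P x -> P y -> P (Order.meet x y);
  pfilter_prime : forall x y : L, P (Order.join x y) -> P x \/ P y
}.

Definition Xspec : set (set L) := [set P | prime_filter P].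

Definition phi (P : set L) : set L := ~` [set dmneg a | a in P].

Definition MaxSpec : set (set L) :=
  [set P | Xspec P /\ forall Q, Xspec Q -> P `<=` Q -> Q = P].

Definition MinSpec : set (set L) :=
  [set P | Xspec P /\ forall Q, Xspec Q -> Q `<=` P -> Q = P].

Definition Body : set (set L) := Xspec `\` (MaxSpec `|` MinSpec).

Definition increasing (C : set (set L)) : Prop :=
  forall P Q, C P -> Xspec Q -> P `<=` Q -> C Q.

Definition decreasing (C : set (set L)) : Prop :=
  forall P Q, C P -> Xspec Q -> Q `<=` P -> C Q.

Definition phi_involutive (C : set (set L)) : Prop :=
  forall P, C P -> C (phi P).

Definition phi_saturated (C : set (set L)) : Prop :=
  [/\ C `<=` Xspec, C !=set0, increasing C, decreasing C & phi_involutive C].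

Definition phi_component (C : set (set L)) : Prop :=
  phi_saturated C /\ forall D, phi_saturated D -> D `<=` C -> D = C.

Definition phi_connected : Prop := exists! C, phi_component C.

End PrimeFilters.

Arguments Xspec {d} L.
Arguments MaxSpec {d} L.
Arguments MinSpec {d} L.
Arguments Body {d} L.
Arguments phi_connected {d} L.

(* Main.v *)
Require Import Defs.
From HB Require Import structures.
From mathcomp Require Import all_boot all_order.
From mathcomp Require Import boolp classical_sets functions cardinality.

(** The argument is Priestley duality, carried out by hand on prime filters.

    For a surjective homomorphism [f : L -> A], let [pullbacks f] be the set of
    the prime filters of [L] of the form [f @^-1` Q], with [Q] a prime filter of
    [A]; this is the closed subset of the spectrum that dualizes the kernel of
    [f].  By the prime filter theorem ([prime_separation]) it determines that
    kernel: [f x = f y] exactly when no member of [pullbacks f] separates [x]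
    from [y].  Preservation of the De Morgan negation makes [pullbacks f] stable
    under [phi], and preservation of the pseudocomplement makes it contain every
    maximal prime filter above any of its members ([pullbacks_max]).

    Let [Y] be any nonempty set of prime filters with these two stability
    properties.  The prime filters lying below some maximal member of [Y] form a
    phi-saturated set, which is the whole spectrum by phi-connectedness
    ([connected_saturated]).  Hence [Y] contains every maximal prime filter and,
    applying [phi], every minimal one: it misses at most points of the body
    ([max_stable_cofull]).  Both cardinality hypotheses put the body inside a
    single phi-orbit, so such a [Y] contains either the whole body or none
    of it.  There are thus at most two candidates for [Y], namely the spectrum
    and the spectrum without its body, and the second one, when it occurs,
    yields the least nontrivial congruence.

    Concretely, consider a subdirect embedding with coordinates [f i].  If some
    [pullbacks (f i)] meets the body, it is the whole spectrum and [f i] is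
    injective.  Otherwise all of them avoid the body, and a coordinate [f i]
    with nontrivial codomain has the largest possible [pullbacks (f i)], hence
    the smallest kernel among all coordinates; as the coordinates are jointly
    injective, that kernel is trivial. *)

Set Implicit Arguments.
Unset Strict Implicit.
Unset Printing Implicit Defensive.

Import Order.TTheory.
Local Open Scope classical_set_scope.
Local Open Scope card_scope.

(** * Prime filters *)

Section Filters.
Variables (d : Order.disp_t) (L : pmAlgebraType d).
Implicit Types (F G P Q M : set L) (x y b : L).

Record lattice_filter F : Prop := LatticeFilter {
  filter_nonempty : F !=set0;
  filter_up : forall x y, (x <= y)%O -> F x -> F y;
  filterI : forall x y, F x -> F y -> F (Order.meet x y)
}.

Lemma prime_lattice_filter P : Xspec L P -> lattice_filter P.
Proof. by case=> P0 _ Pup PI _; split. Qed.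

Lemma prime_top P : Xspec L P -> P Order.top.
Proof. by case=> -[x Px] _ Pup _ _; exact: Pup (lex1 x) Px. Qed.

Lemma prime_bot P : Xspec L P -> ~ P Order.bottom.
Proof.
case=> _ /eqP PT Pup _ _ Pbot; apply: PT; apply/seteqP; split=> // x _.
exact: Pup (le0x x) Pbot.
Qed.

(** The primality of a filter maximal among those avoiding [b] is where
    distributivity enters: if [M] contained [x \/ y] but neither [x] nor [y],
    the filters generated by [M] and [x] and by [M] and [y] would both contain
    [b], hence so would [M].  The maximality clause is kept in the conclusion
    because, for [b] the bottom element, it produces maximal prime filters. *)
Lemma prime_extension F b : lattice_filter F -> ~ F b ->
  exists M, [/\ Xspec L M, F `<=` M, ~ M b &
    forall G, lattice_filter G -> M `<=` G -> ~ G b -> G = M].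
Proof.
move=> FF Fb.
(* Taking unions with [F] makes the empty chain harmless: it yields [F]. *)
pose Fam G := lattice_filter (F `|` G) /\ ~ (F `|` G) b.
have [C Cfam Ctot|A [[AF Ab] Amax]] := @Zorn_bigcup L Fam.
  split; last by case=> // -[G /Cfam[_ nb] Gb]; apply: nb; right.
  have FG G : C G -> lattice_filter (F `|` G) by move=> /Cfam[].
  split; first by have [x Fx] := filter_nonempty FF; exists x; left.
    move=> x y xy [Fx|[G CG Gx]]; first by left; exact: (filter_up FF xy).
    have [Fy|Gy] := filter_up (FG _ CG) xy (or_intror Gx); first by left.
    by right; exists G.
  have FGC G z : C G -> (F `|` G) z -> (F `|` \bigcup_(X in C) X) z.
    by move=> CG [Fz|Gz]; [left|right; exists G].
  move=> x y [Fx|[G CG Gx]] [Fy|[H CH Hy]].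
  - by left; exact: filterI FF _ _ Fx Fy.
  - by apply: (FGC H) => //; apply: (filterI (FG _ CH)); [left|right].
  - by apply: (FGC G) => //; apply: (filterI (FG _ CG)); [right|left].
  - have [GH|HG] := Ctot _ _ CG CH.
      by apply: (FGC H) => //; apply: (filterI (FG _ CH)); right=> //; exact: GH.
    by apply: (FGC G) => //; apply: (filterI (FG _ CG)); right=> //; exact: HG.
set M := F `|` A in AF Ab *.
have Mmax G : lattice_filter G -> M `<=` G -> ~ G b -> G = M.
  move=> GF MG Gb; apply/seteqP; split=> //.
  have FUG : F `|` G = G.
    by apply/seteqP; split=> [x [Fx|//]|x Gx]; [apply: MG; left|right].
  apply: contrapT => nGM; apply: (Amax G); last by split; rewrite FUG.
  split; first by move=> x Ax; apply: MG; right.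
  by move=> GA; apply: nGM => x /GA; right.
(* The filter generated by [M] and an element outside [M] contains [b]. *)
have Mgen x : ~ M x -> exists2 m, M m & (Order.meet m x <= b)%O.
  move=> Mx; apply: contrapT => nb.
  pose G := [set z | exists2 m, M m & (Order.meet m x <= z)%O].
  have [m0 Mm0] := filter_nonempty AF.
  suff GM : G = M by apply: Mx; rewrite -GM; exists m0; rewrite // leIr.
  apply: Mmax => //; last by move=> m Mm; exists m => //; exact: leIl.
  split; first by exists m0; exists m0 => //; exact: leIl.
    by move=> y z yz [m Mm my]; exists m => //; exact: le_trans my yz.
  move=> y z [m Mm my] [n Mn nz]; exists (Order.meet m n).
    exact: filterI AF _ _ Mm Mn.
  rewrite lexI; apply/andP; split.
    by apply: le_trans my; rewrite leI2 ?leIl.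
  by apply: le_trans nz; rewrite leI2 ?leIr.
exists M; split=> //; last by move=> x Fx; left.
split; [exact: filter_nonempty AF| |exact: filter_up AF|exact: filterI AF|].
  by apply/eqP => MT; apply: Ab; rewrite MT.
move=> x y Mxy; apply: contrapT => /not_orP[/Mgen[m Mm mx] /Mgen[n Mn ny]].
apply: Ab.
have Mmn := filterI AF Mm Mn.
apply: (filter_up AF _ (filterI AF Mmn Mxy)).
rewrite meetUr leUx; apply/andP; split.
  by apply: le_trans mx; rewrite leI2 ?leIl.
by apply: le_trans ny; rewrite leI2 ?leIr.
Qed.

Lemma prime_separation x y : ~~ (x <= y)%O ->
  exists P, [/\ Xspec L P, P x & ~ P y].
Proof.
move=> xy; have [|| P [XP xP Py _]] := @prime_extension [set z | (x <= z)%O] y.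
- split; first by exists x => /=.
    by move=> z t zt /= /le_trans; apply.
  by move=> z t /= xz xt; rewrite lexI xz.
- exact/negP.
by exists P; split=> //; exact: xP (lexx x).
Qed.

Lemma prime_ext x y : (forall P, Xspec L P -> (P x <-> P y)) -> x = y.
Proof.
move=> xy; apply: le_anti; apply/andP; split; apply: contrapT => /negP.
  by move=> /prime_separation[P [XP Px Py]]; apply: Py; apply/(xy P XP).
by move=> /prime_separation[P [XP Py Px]]; apply: Px; apply/(xy P XP).
Qed.

Lemma proper_filter_below_max F : lattice_filter F -> ~ F Order.bottom ->
  exists2 M, MaxSpec L M & F `<=` M.
Proof.
move=> FF F0; have [M [XM FM _ Mmax]] := prime_extension FF F0.
exists M => //; split=> // Q XQ MQ.
by apply: Mmax => //; [exact: prime_lattice_filter|exact: prime_bot].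
Qed.

Lemma prime_below_max P : Xspec L P -> exists2 M, MaxSpec L M & P `<=` M.
Proof.
move=> XP; apply: proper_filter_below_max; first exact: prime_lattice_filter.
exact: prime_bot.
Qed.

End Filters.

(** * The involution phi *)

Section Involution.
Variables (d : Order.disp_t) (L : pmAlgebraType d).
Implicit Types (P Q : set L) (x y : L).

Lemma dmnegU x y : dmneg (Order.join x y) = Order.meet (dmneg x) (dmneg y).
Proof. by apply: (can_inj dmnegK); rewrite dmnegI !dmnegK. Qed.

Lemma dmneg0 : dmneg Order.bottom = Order.top :> L.
Proof.
by rewrite -[RHS](joinx1 (dmneg Order.bottom)) -[Order.top in RHS]dmnegK
  -dmnegI meet0x.
Qed.

Lemma dmneg1 : dmneg Order.top = Order.bottom :> L.
Proof. by rewrite -dmneg0 dmnegK. Qed.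

Lemma le_dmneg x y : (x <= y)%O -> (dmneg y <= dmneg x)%O.
Proof. by move=> /meet_idPl <-; rewrite dmnegI leUr. Qed.

Lemma phiE P x : phi P x <-> ~ P (dmneg x).
Proof.
split=> [nPx Px|nPx [a Pa ax]]; last by apply: nPx; rewrite -ax dmnegK.
by apply: nPx; exists (dmneg x); rewrite ?dmnegK.
Qed.

Lemma phiK P : phi (phi P) = P.
Proof.
apply/seteqP; split=> x; last by move=> Px; apply/phiE => /phiE; rewrite dmnegK.
by move=> /phiE nx; apply: contrapT => Px; apply/nx/phiE; rewrite dmnegK.
Qed.

Lemma phiS P Q : P `<=` Q -> phi Q `<=` phi P.
Proof. by move=> PQ x /phiE nQ; apply/phiE => /PQ. Qed.

Lemma phi_prime P : Xspec L P -> Xspec L (phi P).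
Proof.
move=> XP; have P1 := prime_top XP; have P0 := prime_bot XP.
case: XP => _ _ Pup PI PU; split.
- by exists Order.top; apply/phiE; rewrite dmneg1.
- apply/eqP => PT; have /phiE : phi P Order.bottom by rewrite PT.
  by rewrite dmneg0.
- by move=> x y /le_dmneg yx /phiE nx; apply/phiE => /(Pup _ _ yx).
- by move=> x y /phiE nx /phiE ny; apply/phiE; rewrite dmnegI => /PU[].
- move=> x y /phiE; rewrite dmnegU => nxy; apply: contrapT => /not_orP[nx ny].
  by apply/nxy/PI; apply: contrapT => /phiE.
Qed.

Lemma phi_max P : MaxSpec L P -> MinSpec L (phi P).
Proof.
move=> [XP Pmax]; split; first exact: phi_prime.
move=> Q XQ /phiS; rewrite phiK => PQ.
by rewrite -(Pmax (phi Q)) ?phiK //; exact: phi_prime.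
Qed.

Lemma phi_min P : MinSpec L P -> MaxSpec L (phi P).
Proof.
move=> [XP Pmin]; split; first exact: phi_prime.
move=> Q XQ /phiS; rewrite phiK => QP.
by rewrite -(Pmin (phi Q)) ?phiK //; exact: phi_prime.
Qed.

Lemma min_below_prime P : Xspec L P -> exists2 m, MinSpec L m & m `<=` P.
Proof.
move=> /phi_prime/prime_below_max[M maxM /phiS]; rewrite phiK => MP.
by exists (phi M) => //; exact: phi_max.
Qed.

(** * Connectedness *)

(** The smallest saturated set around a point is a component, because the
    relative complement of a saturated set in it is again saturated; so when
    there is only one component, it contains every point and lies inside every
    saturated set. *)
Lemma connected_saturated (D : set (set L)) :
  phi_connected L -> phi_saturated D -> D = Xspec L.
Proof.
move=> [C [_ Cuniq]].
pose S P := [set Q | Xspec L Q /\ forall E, phi_saturated E -> E P -> E Q].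
have Sself P : Xspec L P -> S P P by [].
have Ssat P : Xspec L P -> phi_saturated (S P).
  move=> XP; split.
  - by move=> Q [].
  - by exists P; exact: Sself.
  - move=> Q R [XQ SQ] XR QR; split=> // E Esat EP.
    by have [_ _ up _ _] := Esat; apply: up QR => //; exact: SQ.
  - move=> Q R [XQ SQ] XR RQ; split=> // E Esat EP.
    by have [_ _ _ down _] := Esat; apply: down RQ => //; exact: SQ.
  - move=> Q [XQ SQ]; split; first exact: phi_prime.
    by move=> E Esat EP; have [_ _ _ _ inv] := Esat; apply: inv; exact: SQ.
have Scomp P : Xspec L P -> S P = C.
  move=> XP; apply/esym/Cuniq; split; first exact: Ssat.
  move=> E Esat ES; apply/seteqP; split=> // Q [XQ SQ].
  apply: contrapT => EQ; have EP : ~ E P by move=> EP; apply: EQ; exact: SQ.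
  have [EX [R ER] Eup Edown Einv] := Esat.
  have [SX _ Sup Sdown Sinv] := Ssat _ XP.
  have Tsat : phi_saturated (S P `\` E).
    split.
    - by move=> T [/SX].
    - by exists P; split=> //; exact: Sself.
    - move=> T U [ST ET] XU TU; split; first exact: Sup ST XU TU.
      by move=> EU; apply: ET; apply: Edown EU _ TU; exact: SX.
    - move=> T U [ST ET] XU UT; split; first exact: Sdown ST XU UT.
      by move=> EU; apply: ET; apply: Eup EU _ UT; exact: SX.
    - move=> T [ST ET]; split; first exact: Sinv.
      by move=> /Einv; rewrite phiK.
  have [_ SR] := ES _ ER.
  by have [] := SR _ Tsat (conj (Sself _ XP) EP).
move=> Dsat; have [DX [P DP] _ _ _] := Dsat.
apply/seteqP; split=> // Q XQ.
have [_] : S P Q by rewrite (Scomp P (DX _ DP)) -(Scomp Q XQ); exact: Sself.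
by apply.
Qed.

(** The congruences of [L] are dual to the sets with these properties that are
    moreover closed in the Priestley topology. *)
Record max_stable (Y : set (set L)) : Prop := MaxStable {
  stable_prime : Y `<=` Xspec L;
  stable_phi : phi_involutive Y;
  stable_max : forall P M, Y P -> MaxSpec L M -> P `<=` M -> Y M
}.

(** The prime filters below a maximal member of [Y] form a saturated set: for
    stability under [phi], a minimal [m] below [Q] is also below the maximal
    member [M] above [Q], and [phi M] below [phi m] brings [phi m], which lies
    above [phi Q], into [Y]. *)
Lemma max_stable_cofull (Y : set (set L)) : phi_connected L ->
  max_stable Y -> Y !=set0 -> Xspec L `\` Body L `<=` Y.
Proof.
move=> connL [YX Yphi Ymax] [P0 YP0].
have Ymin P m : Y P -> MinSpec L m -> m `<=` P -> Y m.
  move=> YP minm mP; rewrite -(phiK m); apply/Yphi.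
  by apply: (Ymax (phi P)); [exact: Yphi|exact: phi_min|exact: phiS].
pose D := [set Q | Xspec L Q /\ exists M, [/\ MaxSpec L M, Y M & Q `<=` M]].
have Dphi : phi_involutive D.
  move=> Q [XQ [M [maxM YM QM]]]; split; first exact: phi_prime.
  have [m minm mQ] := min_below_prime XQ.
  exists (phi m); split; [exact: phi_min| |exact: phiS].
  by apply/Yphi/(Ymin M) => //; exact: subset_trans mQ QM.
have Ddown : decreasing D.
  move=> Q R [_ [M [maxM YM QM]]] XR RQ; split=> //.
  by exists M; split=> //; exact: subset_trans RQ QM.
have DE : D = Xspec L.
  apply: connected_saturated => //; split=> //.
  - by move=> Q [].
  - have [M maxM PM] := prime_below_max (YX _ YP0).
    exists P0; split; first exact: YX.
    by exists M; split=> //; exact: Ymax maxM PM.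
  - move=> P Q DP XQ PQ; rewrite -(phiK Q); apply/Dphi.
    by apply: Ddown (phiS PQ); [exact: Dphi|exact: phi_prime].
have Ymaxs M : MaxSpec L M -> Y M.
  move=> [XM Mmax]; have [_ [N [[XN _] YN MN]]] : D M by rewrite DE.
  by rewrite -(Mmax N).
move=> Q [XQ nQ]; have [maxQ|nmaxQ] := pselect (MaxSpec L Q); first exact: Ymaxs.
have [minQ|nminQ] := pselect (MinSpec L Q).
  by rewrite -(phiK Q); apply/Yphi/Ymaxs/phi_min.
by exfalso; apply: nQ; split=> // -[].
Qed.

End Involution.

(** * Prime filters pulled back along a homomorphism *)

Section Pullbacks.
Variables (d d' : Order.disp_t) (L : pmAlgebraType d) (A : pmAlgebraType d').
Variable f : L -> A.
Hypothesis fm : pm_morphism f.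

Definition pullbacks : set (set L) := [set f @^-1` Q | Q in Xspec A].

Let f_le x y : (x <= y)%O -> (f x <= f y)%O.
Proof. by move=> /meet_idPl xy; rewrite leEmeet -(pm_morphI fm) xy. Qed.

Lemma pullback_prime (Q : set A) : Xspec A Q -> Xspec L (f @^-1` Q).
Proof.
move=> XQ; have Q1 := prime_top XQ; have Q0 := prime_bot XQ.
case: XQ => _ _ Qup QI QU; split.
- by exists Order.top; rewrite /= (pm_morph1 fm).
- apply/eqP => QT; apply: Q0; rewrite -(pm_morph0 fm).
  by have : (f @^-1` Q) Order.bottom by rewrite QT.
- by move=> x y /f_le; exact: Qup.
- by move=> x y Qx Qy; rewrite /= (pm_morphI fm); exact: QI.
- by move=> x y; rewrite /= (pm_morphU fm) => /QU.
Qed.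

Lemma pullbacks_phi : phi_involutive pullbacks.
Proof.
move=> _ [Q XQ <-]; exists (phi Q); first exact: phi_prime.
apply/seteqP; split=> x /phiE nx; apply/phiE; move: nx;
  by rewrite /= (pm_morphN fm).
Qed.

(** For a maximal [M] above [f @^-1` Q], the image of [M] is a proper filter:
    [f m = 0] would put [f (pcompl m) = 1] in [Q], hence [pcompl m] in [M]
    together with [m].  Any maximal filter above this image pulls back to a
    prime filter containing [M], that is, to [M]. *)
Lemma pullbacks_max (fsurj : forall z, exists x, f x = z) (P M : set L) :
  pullbacks P -> MaxSpec L M -> P `<=` M -> pullbacks M.
Proof.
move=> [Q XQ <-] [XM Mmax] QM.
have MF := prime_lattice_filter XM.
have FF : lattice_filter (f @` M).
  split; first by exists (f Order.top), Order.top => //; exact: prime_top.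
    move=> y z /[swap] -[m Mm <-] mz; have [x xz] := fsurj z.
    exists (Order.join m x).
      by apply: filter_up MF _ _ _ Mm; exact: leUl.
    by rewrite (pm_morphU fm) xz; exact/join_idPr.
  move=> _ _ [m Mm <-] [n Mn <-]; exists (Order.meet m n).
    exact: filterI MF _ _ Mm Mn.
  exact: (pm_morphI fm).
have F0 : ~ (f @` M) Order.bottom.
  move=> [m Mm fm0]; apply: (prime_bot XM).
  have mC0 : Order.meet m (pcompl m) = Order.bottom.
    by apply/eqP; rewrite meet_eq0_pcompl.
  rewrite -mC0; apply: (filterI MF) => //; apply: QM => /=.
  rewrite (pm_morphC fm) fm0.
  apply: (filter_up (prime_lattice_filter XQ) _ (prime_top XQ)).
  by rewrite -meet_eq0_pcompl meet0x.
have [N [XN _] MN] := proper_filter_below_max FF F0.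
exists N => //; apply: Mmax; first exact: pullback_prime.
by move=> x Mx; apply: MN; exists x.
Qed.

Lemma pullbacks_stable :
  (forall z, exists x, f x = z) -> max_stable pullbacks.
Proof.
move=> fsurj; split; [|exact: pullbacks_phi|exact: pullbacks_max].
by move=> _ [Q XQ <-]; exact: pullback_prime.
Qed.

Lemma pullbacks_kernel x y :
  f x = f y <-> forall P, pullbacks P -> (P x <-> P y).
Proof.
split=> [fxy _ [Q _ <-]|xy]; first by rewrite /= fxy.
by apply: prime_ext => Q XQ; apply: (xy (f @^-1` Q)); exists Q.
Qed.

Lemma pullbacks_full_inj : Xspec L `<=` pullbacks -> injective f.
Proof.
move=> full x y /pullbacks_kernel xy.
by apply: prime_ext => P /full; exact: xy.
Qed.

Lemma inj_surj_bijective :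
  (forall z, exists x, f x = z) -> injective f -> bijective f.
Proof.
by move=> /choice[g fg] finj; exists g => // x; apply: finj; rewrite fg.
Qed.

End Pullbacks.

(** * Subdirect irreducibility *)

Section Irreducible.
Variables (d : Order.disp_t) (L : pmAlgebraType d).

Lemma connected_nontrivial :
  phi_connected L -> Order.bottom <> Order.top :> L.
Proof.
move=> [C [[[CX [P /CX XP] _ _ _] _] _]] bt.
by apply: (prime_bot XP); rewrite bt; exact: prime_top.
Qed.

Lemma small_body_orbit :
  (exists2 n : nat, (n < 2)%N & Body L #= `I_n) \/
  (exists P : set L, phi P <> P /\ Body L = [set P; phi P]) ->
  forall P Q, Body L P -> Body L Q -> Q = P \/ Q = phi P.
Proof.
move=> [[n n2 /card_set_bijP[g [gI ginj _]]] P Q BP BQ|[R [_ ->]] P Q].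
  left; apply: ginj; rewrite ?inE //.
  have := gI _ BQ; have := gI _ BP => {gI} /=.
  by case: n n2 => [|[|n]] // _; case: (g P) => [|?] //; case: (g Q).
by move=> [->|->] [->|->]; rewrite ?phiK; [left|right|right|left].
Qed.

Lemma body_orbit_irreducible : phi_connected L ->
  (forall P Q, Body L P -> Body L Q -> Q = P \/ Q = phi P) ->
  subdirectly_irreducible L.
Proof.
move=> connL orbit I dA A f [fm fsep fsurj].
suff [i finj] : exists i, injective (f i) by exists i; exact: inj_surj_bijective.
have Ystable i := pullbacks_stable (fm i) (fsurj i).
have [[j [P [YP BP]]]|noBody] :=
    pselect (exists j P, pullbacks (f j) P /\ Body L P).
  exists j; apply: pullbacks_full_inj => Q XQ.
  have [BQ|nBQ] := pselect (Body L Q).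
    by have [->|->] := orbit _ _ BP BQ => //; exact: (stable_phi (Ystable j)).
  by apply: (max_stable_cofull connL (Ystable j)) => //; exists P.
have [i fi01] : exists i, f i Order.bottom <> f i Order.top.
  apply: contrapT => /forallNP triv; apply: (connected_nontrivial connL).
  by apply: fsep => i; apply: contrapT; exact: triv.
exists i => x y /pullbacks_kernel xy; apply: fsep => j.
apply/pullbacks_kernel => P YP; apply: xy.
apply: (max_stable_cofull connL (Ystable i)).
  (* Were there no pullbacks along [f i], its kernel would be total. *)
  apply: contrapT => /forallNP Y0; apply: fi01.
  by apply/pullbacks_kernel => Q YQ; have := Y0 Q.
split; first exact: (stable_prime (Ystable j)).
by move=> BP; apply: noBody; exists j, P.
Qed.

End Irreducible.

Theorem theorem2p8 (d : Order.disp_t) (L : pmAlgebraType d) :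
  phi_connected L ->
  (exists2 n : nat, (n < 2)%N & Body L #= `I_n) \/
  (exists P : set L, phi P <> P /\ Body L = [set P; phi P]) ->
  subdirectly_irreducible L.
Proof. by move=> connL /small_body_orbit; exact: body_orbit_irreducible. Qed.
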